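(* Let $F_1,F_2$ be two distinct points in the Euclidean plane and let $O$ be the midpoint of the segment $F_1F_2$. Let $X\neq O$ be a point of the lemniscate of Bernoulli with foci $F_1$ and $F_2$, and let $F\in\{F_1,F_2\}$ be the focus for which the angle $\angle XOF$ is acute or zero. Take the line through $X$ containing a ray $XN$ such that $\angle OXN=2\angle XOF$, where $N$ lies on the same side of the line $OX$ as $F$ (if $\angle XOF=0$, the line is $OX$ itself). Then this line is the normal to the lemniscate at $X$, i.e. it is perpendicular to the tangent line of the lemniscate at $X$.
   Context: The lemniscate of Bernoulli with foci $F_1\neq F_2$ is the set of points $X$ of the plane such that $|F_1X|\cdot|F_2X|=\frac14|F_1F_2|^2$. *)

(* Defs.v *)
From HB Require Import structures.
From mathcomp Require Import all_boot all_order all_algebra.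
From mathcomp Require Import all_classical all_reals all_analysis.

Set Implicit Arguments.
Unset Strict Implicit.
Unset Printing Implicit Defensive.

Import Order.TTheory GRing.Theory Num.Theory.
Import numFieldNormedType.Exports.

Local Open Scope classical_set_scope.
Local Open Scope ring_scope.

(* The Euclidean plane is 'rV[R]_2.  The norm `|_| that the library puts on row
   vectors is the sup norm, so the Euclidean one is defined here; both induce
   the same topology, which is the one used for limits below. *)

Definition dot (R : realType) (u v : 'rV[R]_2) : R :=
  \sum_(i < 2) u 0 i * v 0 i.

Definition enorm (R : realType) (u : 'rV[R]_2) : R := Num.sqrt (dot u u).

Definition dist (R : realType) (A B : 'rV[R]_2) : R := enorm (B - A).

Definition midpoint (R : realType) (A B : 'rV[R]_2) : 'rV[R]_2 :=
  2^-1 *: (A + B).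

(* The unoriented angle ABC at the vertex B, in [0, pi].  It is meaningful only
   for A <> B and C <> B. *)
Definition angle (R : realType) (A B C : 'rV[R]_2) : R :=
  acos (dot (A - B) (C - B) / (enorm (A - B) * enorm (C - B))).

(* The line AB; it degenerates to {A} when A = B. *)
Definition line (R : realType) (A B : 'rV[R]_2) : set 'rV[R]_2 :=
  [set P | exists t : R, P = A + t *: (B - A)].

Definition is_line (R : realType) (L : set 'rV[R]_2) : Prop :=
  exists A B : 'rV[R]_2, A <> B /\ L = line A B.

Definition segment (R : realType) (A B : 'rV[R]_2) : set 'rV[R]_2 :=
  [set P | exists t : R, 0 <= t <= 1 /\ P = A + t *: (B - A)].

(* P and Q lie in the same open half-plane bounded by the line AB. *)
Definition same_side (R : realType) (A B P Q : 'rV[R]_2) : Prop :=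
  line A B `&` segment P Q = set0.

Definition perpendicular (R : realType) (L M : set 'rV[R]_2) : Prop :=
  [/\ is_line L, is_line M &
      forall A B P Q : 'rV[R]_2, L A -> L B -> M P -> M Q ->
        dot (B - A) (Q - P) = 0].

(* The angle in [0, pi/2] between the lines XY and XZ. *)
Definition line_angle (R : realType) (X Y Z : 'rV[R]_2) : R :=
  Num.min (angle Y X Z) (pi - angle Y X Z).

(* T is the limit of the secants XY as Y tends to X along C, Y <> X; the point X
   must not be isolated in C, as otherwise every line through X would qualify. *)
Definition tangent_line (R : realType) (C : set 'rV[R]_2) (X : 'rV[R]_2)
    (T : set 'rV[R]_2) : Prop :=
  [/\ C X, limit_point C X &
      exists Z : 'rV[R]_2, [/\ Z <> X, T = line X Z &
        line_angle X Y Z @[Y --> within C X^'] --> (0 : R)]].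

Definition normal_line (R : realType) (C : set 'rV[R]_2) (X : 'rV[R]_2)
    (L : set 'rV[R]_2) : Prop :=
  L X /\ exists T : set 'rV[R]_2,
    unique (tangent_line C X) T /\ perpendicular L T.

Definition lemniscate (R : realType) (F1 F2 : 'rV[R]_2) : set 'rV[R]_2 :=
  [set X | dist F1 X * dist F2 X = 4^-1 * dist F1 F2 ^+ 2].

(* Main.v *)
Require Import Defs.
From HB Require Import structures.
From mathcomp Require Import all_boot all_order all_algebra.
From mathcomp Require Import all_classical all_reals all_analysis.
From mathcomp Require Import ring lra.

Set Implicit Arguments.
Unset Strict Implicit.
Unset Printing Implicit Defensive.

Import Order.TTheory GRing.Theory Num.Theory.
Import numFieldNormedType.Exports.

Local Open Scope classical_set_scope.
Local Open Scope ring_scope.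

(** Put the origin at the centre O and write c = F - O, x = X - O.  Squaring the
    defining equation turns the lemniscate into the quartic
      |x|^4 + 2 |x|^2 |c|^2 = 4 (x.c)^2,
    whose gradient at x is, up to the factor 4,
      G = (|x|^2 + |c|^2) x - 2 (x.c) c.
    By the quartic, 2 G.x = |x|^4, so G does not vanish off the centre.

    The tangent at X is the line directed by G turned by a right angle
    ([tangent_line_lemniscate]).  Indeed, if h is a chord from X, subtracting the
    equations of its two ends leaves |G.h| = O(|h|^2) ([gradient_dot_le]), and
    G.h / (|G||h|) is the sine of the angle of the chord with that line.  The
    point X is not isolated, because each ray from O in a direction close to x
    meets the curve at an explicit distance that depends continuously on the
    direction ([lemniscate_limit_point]).  Two lines through a non-isolated point
    that both make vanishing angles with the chords are equal, which gives
    uniqueness of the tangent ([tangent_line_eq]).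

    It remains to see that the given line is directed by G.  Let a be the angle
    XOF.  In an orthonormal frame whose first vector is x / |x| and whose second
    one points towards F, c = |c| (cos a, sin a) and XN is directed by
    n = (- cos 2a, sin 2a); the quartic reads |x|^2 = 2 |c|^2 cos 2a, whence
    G = - |x| |c|^2 n ([double_angle_normal]).  If a = 0 then c, hence G, is
    parallel to x. *)

(** * Dot and cross products in the plane *)

Definition cross (R : realType) (u v : 'rV[R]_2) : R :=
  u 0 0 * v 0 1 - u 0 1 * v 0 0.

Definition rot90 (R : realType) (u : 'rV[R]_2) : 'rV[R]_2 :=
  \row_(j < 2) if j == 0 then - u 0 1 else u 0 0.

Lemma dotE (R : realType) (u v : 'rV[R]_2) :
  dot u v = u 0 0 * v 0 0 + u 0 1 * v 0 1.
Proof.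
rewrite /dot !big_ord_recl big_ord0 addr0.
by congr (_ + u 0 _ * v 0 _); apply: val_inj.
Qed.

Lemma row2P (R : realType) (u v : 'rV[R]_2) :
  u 0 0 = v 0 0 -> u 0 1 = v 0 1 -> u = v.
Proof.
move=> e0 e1; apply/rowP => -[[|[|//]] p].
- by rewrite (_ : Ordinal p = 0) //; apply: val_inj.
- by rewrite (_ : Ordinal p = 1) //; apply: val_inj.
Qed.

Lemma rot90_0 (R : realType) (u : 'rV[R]_2) : rot90 u 0 0 = - u 0 1.
Proof. by rewrite mxE. Qed.

Lemma rot90_1 (R : realType) (u : 'rV[R]_2) : rot90 u 0 1 = u 0 0.
Proof. by rewrite mxE. Qed.

(** Reduces an identity between dot and cross products to one between
   coordinates. *)
Definition coordE :=
  (dotE, fun R u v => erefl : @cross R u v = u 0 0 * v 0 1 - u 0 1 * v 0 0,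
   rot90_0, rot90_1).

Lemma dot_ge0 (R : realType) (u : 'rV[R]_2) : 0 <= dot u u.
Proof. by rewrite dotE -!expr2 addr_ge0 ?sqr_ge0. Qed.

Lemma dot_eq0 (R : realType) (u : 'rV[R]_2) : (dot u u == 0) = (u == 0).
Proof.
apply/idP/eqP => [|->]; last by rewrite dotE !mxE mul0r addr0.
rewrite dotE -!expr2 paddr_eq0 ?sqr_ge0 // !sqrf_eq0 => /andP[/eqP e0 /eqP e1].
by apply: row2P; rewrite mxE.
Qed.

Lemma dot_gt0 (R : realType) (u : 'rV[R]_2) : (0 < dot u u) = (u != 0).
Proof. by rewrite lt_def dot_ge0 andbT dot_eq0. Qed.

Lemma enorm_ge0 (R : realType) (u : 'rV[R]_2) : 0 <= enorm u.
Proof. exact: sqrtr_ge0. Qed.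

Lemma enorm_gt0 (R : realType) (u : 'rV[R]_2) : (0 < enorm u) = (u != 0).
Proof. by rewrite /enorm sqrtr_gt0 dot_gt0. Qed.

Lemma enorm_sqr (R : realType) (u : 'rV[R]_2) : enorm u ^+ 2 = dot u u.
Proof. by rewrite sqr_sqrtr ?dot_ge0. Qed.

(** Lagrange's identity, i.e. cos^2 + sin^2 = 1 multiplied by the squared norms:
    it carries every passage between cosines and sines below. *)
Lemma dot_cross_sqr (R : realType) (u v : 'rV[R]_2) :
  dot u v ^+ 2 + cross u v ^+ 2 = dot u u * dot v v.
Proof. by rewrite !coordE; ring. Qed.

Lemma cauchy_schwarz (R : realType) (u v : 'rV[R]_2) :
  `|dot u v| <= enorm u * enorm v.
Proof.
rewrite -(@ler_pXn2r _ 2) ?nnegrE ?mulr_ge0 ?enorm_ge0 //.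
by rewrite real_normK ?num_real // exprMn !enorm_sqr -dot_cross_sqr lerDl sqr_ge0.
Qed.

(** * Angles and lines *)

Lemma cos_itv (R : realType) (u v : 'rV[R]_2) :
  -1 <= dot u v / (enorm u * enorm v) <= 1.
Proof.
rewrite -ler_norml normrM normfV [ `|_ * _|]ger0_norm ?mulr_ge0 ?enorm_ge0 //.
have [->|nz] := eqVneq (enorm u * enorm v) 0; first by rewrite invr0 mulr0.
rewrite ler_pdivrMr ?mul1r ?cauchy_schwarz //.
by rewrite lt_def nz mulr_ge0 ?enorm_ge0.
Qed.

Lemma angle_itv (R : realType) (A B C : 'rV[R]_2) : 0 <= angle A B C <= pi.
Proof. by rewrite /angle acos_ge0 ?acos_lepi // cos_itv. Qed.

Lemma cos_angle (R : realType) (A B C : 'rV[R]_2) :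
  cos (angle A B C) =
    dot (A - B) (C - B) / (enorm (A - B) * enorm (C - B)).
Proof. by rewrite /angle acosK // in_itv /= cos_itv. Qed.

(** The sine of the angle between the lines XY and XZ.  Unlike the angle itself it
    is an algebraic expression, so that tangency can be tested on it. *)
Definition sine (R : realType) (X Y Z : 'rV[R]_2) : R :=
  `|cross (Y - X) (Z - X)| / (enorm (Y - X) * enorm (Z - X)).

(** An angle and its supplement have the same sine. *)
Lemma sin_line_angle (R : realType) (X Y Z : 'rV[R]_2) :
  Y != X -> Z != X -> sin (line_angle X Y Z) = sine X Y Z.
Proof.
move=> YX ZX; have -> : sin (line_angle X Y Z) = sin (angle Y X Z).
  rewrite /line_angle /Num.min; case: ifP => // _.
  by rewrite addrC sinDpi sinN opprK.
rewrite /angle sin_acos ?cos_itv // /sine.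
have n1 : enorm (Y - X) != 0 by rewrite gt_eqF // enorm_gt0 subr_eq0.
have n2 : enorm (Z - X) != 0 by rewrite gt_eqF // enorm_gt0 subr_eq0.
set u := Y - X; set v := Z - X.
have -> : 1 - (dot u v / (enorm u * enorm v)) ^+ 2 =
          (cross u v / (enorm u * enorm v)) ^+ 2.
  rewrite !exprMn !exprVn !exprMn !enorm_sqr.
  rewrite -[X in X - _](@divff _ (dot u u * dot v v)).
    by rewrite -mulrBl; congr (_ / _); rewrite -dot_cross_sqr; ring.
  by rewrite -!enorm_sqr mulf_neq0 ?expf_neq0.
by rewrite sqrtr_sqr normrM normfV [ `|_ * _|]ger0_norm ?mulr_ge0 ?enorm_ge0.
Qed.

Lemma line_angle_itv (R : realType) (X Y Z : 'rV[R]_2) :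
  0 <= line_angle X Y Z <= pi / 2.
Proof.
have /andP[a0 a1] := angle_itv Y X Z.
rewrite /line_angle; move: (angle Y X Z) a0 a1 => a a0 a1.
by rewrite /Num.min; case: ltP => h; apply/andP; split; lra.
Qed.

Lemma near_within_dnbhs_neq (R : realType) (C : set 'rV[R]_2) (X : 'rV[R]_2) :
  \forall Y \near within C X^', Y != X.
Proof.
have H : \forall Y \near X^', Y != X by exact: withinT.
by apply: (@cvg_within _ X^' _ C).
Qed.

Lemma asin0 (R : realType) : asin (0 : R) = 0.
Proof.
rewrite -[X in asin X](@sin0 R) sinK // in_itv /=.
by have := @pi_ge0 R => h; apply/andP; split; lra.
Qed.

(** On [0, pi/2] the functions sin and asin are inverse to each other and
    continuous at 0, so an angle tends to 0 exactly when its sine does. *)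
Lemma line_angle_cvg0 (R : realType) (C : set 'rV[R]_2) (X Z : 'rV[R]_2) :
  Z != X ->
  (line_angle X Y Z @[Y --> within C X^'] --> (0 : R)) <->
  (sine X Y Z @[Y --> within C X^'] --> (0 : R)).
Proof.
move=> ZX; split=> h.
- have h1 : sin (line_angle X Y Z) @[Y --> within C X^'] --> (0 : R).
    by rewrite -[X in _ --> X](@sin0 R); apply: continuous_cvg h; exact: continuous_sin.
  apply: cvg_trans h1; apply: near_eq_cvg.
  near=> Y; rewrite sin_line_angle //.
  by near: Y; exact: near_within_dnbhs_neq.
- have h1 : asin (sine X Y Z) @[Y --> within C X^'] --> (0 : R).
    rewrite -[X in _ --> X](@asin0 R); apply: continuous_cvg h.
    by apply: continuous_asin; apply/andP; split; lra.
  apply: cvg_trans h1; apply: near_eq_cvg.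
  near=> Y; rewrite -sin_line_angle //; last first.
    by near: Y; exact: near_within_dnbhs_neq.
  rewrite sinK // in_itv /=; have := line_angle_itv X Y Z.
  by move=> /andP[a b]; apply/andP; split; have := @pi_ge0 R => c; lra.
Unshelve. all: by end_near. Qed.

Lemma line_sub (R : realType) (X Z Z' : 'rV[R]_2) (k : R) :
  Z' - X = k *: (Z - X) -> line X Z' `<=` line X Z.
Proof. by move=> e _ [t ->]; exists (t * k); rewrite e scalerA. Qed.

Lemma collinear (R : realType) (p q : 'rV[R]_2) :
  p != 0 -> cross p q = 0 -> q = (dot p q / dot p p) *: p.
Proof.
rewrite -dot_gt0 => pp c; have nz : dot p p != 0 by rewrite gt_eqF.
apply: row2P; rewrite mxE; apply: (mulfI nz);
  rewrite mulrA [_ * (_ / _)]mulrC divfK //.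
- have -> : dot p q * p 0 0 = dot p p * q 0 0 + p 0 1 * cross p q.
    by rewrite !coordE; ring.
  by rewrite c mulr0 addr0.
- have -> : dot p q * p 0 1 = dot p p * q 0 1 - p 0 0 * cross p q.
    by rewrite !coordE; ring.
  by rewrite c mulr0 subr0.
Qed.

Lemma line_eq (R : realType) (X Z Z' : 'rV[R]_2) :
  Z != X -> Z' != X -> cross (Z - X) (Z' - X) = 0 -> line X Z = line X Z'.
Proof.
suff H (A B : 'rV[R]_2) : A != X -> cross (A - X) (B - X) = 0 ->
    line X B `<=` line X A.
  move=> ZX ZX' c; apply/seteqP; split; apply: H => //.
  by apply/eqP; rewrite -oppr_eq0 -c /cross; apply/eqP; ring.
rewrite -subr_eq0 => AX /(collinear AX); exact: line_sub.
Qed.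

(** * Uniqueness of the tangent line *)

(** Divided by |h|^2 |d| |e|, this is sin (v - u) = cos u sin v - sin u cos v for
    the angles u, v from h to d and e. *)
Lemma dot_cross_tangents (R : realType) (h d e : 'rV[R]_2) :
  dot h h * cross d e = dot h d * cross h e - cross h d * dot h e.
Proof. by rewrite !coordE; ring. Qed.

Lemma limit_point_proper (R : realType) (C : set 'rV[R]_2) (X : 'rV[R]_2) :
  limit_point C X -> ProperFilter (within C X^').
Proof.
move=> lim; apply: Build_ProperFilter_ex => P; rewrite /within /= => nP.
have {}nP : nbhs X [set Y | Y != X -> C Y -> P Y] by [].
by have [Y [YX CY PY]] := lim _ nP; exists Y; exact: PY.
Qed.

(** The sine of the angle between XZ and XZ' is at most the sum of the sines of
    the angles that these lines make with any chord XY; this sum tends to 0. *)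
Lemma sine_line_eq (R : realType) (C : set 'rV[R]_2) (X Z Z' : 'rV[R]_2) :
  limit_point C X -> Z != X -> Z' != X ->
  sine X Y Z @[Y --> within C X^'] --> (0 : R) ->
  sine X Y Z' @[Y --> within C X^'] --> (0 : R) ->
  line X Z = line X Z'.
Proof.
move=> /limit_point_proper PF ZX ZX' hZ hZ'.
apply: line_eq => //; set d := Z - X; set e := Z' - X.
have [d0 e0] : 0 < enorm d /\ 0 < enorm e by rewrite !enorm_gt0 !subr_eq0.
have h0 : enorm d * enorm e * (sine X Y Z + sine X Y Z')
    @[Y --> within C X^'] --> (0 : R).
  rewrite -[X in _ --> X](mulr0 (enorm d * enorm e)).
  by apply: cvgM; [exact: cvg_cst|rewrite -[0]addr0; exact: cvgD].
apply/eqP; rewrite -normr_le0; apply: (cvgr_to_ge h0).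
near=> Y.
have YX : Y != X by near: Y; exact: near_within_dnbhs_neq.
rewrite /sine -/d -/e; set h := Y - X.
have hp : 0 < enorm h by rewrite enorm_gt0 subr_eq0.
have -> : enorm d * enorm e * (`|cross h d| / (enorm h * enorm d) +
             `|cross h e| / (enorm h * enorm e)) =
          (enorm h * enorm d * `|cross h e| + `|cross h d| * (enorm h * enorm e))
           / enorm h ^+ 2.
  by field; rewrite !gt_eqF.
rewrite ler_pdivlMr ?exprn_gt0 // mulrC.
have -> : enorm h ^+ 2 * `|cross d e| = `|dot h h * cross d e|.
  by rewrite normrM ger0_norm ?dot_ge0 ?enorm_sqr.
rewrite dot_cross_tangents; apply: le_trans (ler_normB _ _) _.
by rewrite !normrM lerD ?ler_wpM2r ?ler_wpM2l ?cauchy_schwarz.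
Unshelve. all: by end_near. Qed.

Lemma tangent_line_eq (R : realType) (C : set 'rV[R]_2) (X : 'rV[R]_2) T T' :
  tangent_line C X T -> tangent_line C X T' -> T = T'.
Proof.
move=> [_ lim [Z [/eqP ZX -> hZ]]] [_ _ [Z' [/eqP ZX' -> hZ']]].
by apply: (sine_line_eq lim) => //; apply/line_angle_cvg0.
Qed.

(** * The tangent line of the lemniscate *)

(** The squared defining equation is |w - c|^2 |w + c|^2 = |c|^4 with w = Y - O;
    squaring loses nothing as both sides are nonnegative. *)
Lemma lemniscate_center (R : realType) (O c Y : 'rV[R]_2) :
  lemniscate (O + c) (O - c) Y <->
  dot (Y - O) (Y - O) ^+ 2 + 2 * dot (Y - O) (Y - O) * dot c c =
    4 * dot (Y - O) c ^+ 2.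
Proof.
rewrite /lemniscate /= /dist.
have -> : Y - (O + c) = (Y - O) - c by rewrite opprD addrA.
have -> : Y - (O - c) = (Y - O) + c by rewrite opprD opprK addrA.
have -> : O - c - (O + c) = - (c + c) by rewrite [- (O + c)]opprD addrACA subrr add0r opprD.
set w := Y - O.
have -> : (enorm (w - c) * enorm (w + c) = 4^-1 * enorm (- (c + c)) ^+ 2) <->
    (dot (w - c) (w - c) * dot (w + c) (w + c) = dot c c ^+ 2).
  have -> : 4^-1 * enorm (- (c + c)) ^+ 2 = dot c c.
    by rewrite enorm_sqr !coordE !mxE; field.
  rewrite -!enorm_sqr -exprMn; split=> [->//|/eqP].
  rewrite eqrXn2 ?mulr_ge0 ?enorm_ge0 ?sqr_ge0 //.
  by move/eqP.
have -> : dot (w - c) (w - c) * dot (w + c) (w + c) =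
    dot w w ^+ 2 + 2 * dot w w * dot c c - 4 * dot w c ^+ 2 + dot c c ^+ 2.
  by rewrite !coordE !mxE; ring.
by split=> h; lra.
Qed.

(** A quarter of the gradient at x of |x|^4 + 2 |x|^2 |c|^2 - 4 (x.c)^2. *)
Definition gradient (R : realType) (c x : 'rV[R]_2) : 'rV[R]_2 :=
  (dot x x + dot c c) *: x - (2 * dot x c) *: c.

Lemma dot_gradient (R : realType) (c x : 'rV[R]_2) :
  dot x x ^+ 2 + 2 * dot x x * dot c c = 4 * dot x c ^+ 2 ->
  2 * dot (gradient c x) x = dot x x ^+ 2.
Proof.
move=> h; have -> : dot (gradient c x) x = (dot x x + dot c c) * dot x x - 2 * dot x c ^+ 2.
  by rewrite !coordE !mxE !coordE; ring.
lra.
Qed.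

Lemma gradient_neq0 (R : realType) (c x : 'rV[R]_2) : x != 0 ->
  dot x x ^+ 2 + 2 * dot x x * dot c c = 4 * dot x c ^+ 2 ->
  gradient c x != 0.
Proof.
move=> x0 /dot_gradient; apply: contra_eqN => /eqP ->.
rewrite (_ : dot 0 x = 0); last by rewrite coordE !mxE; ring.
by rewrite mulr0 eq_sym expf_eq0 dot_eq0.
Qed.

(** The difference of the two equations is 4 h.G plus terms of order at least 2 in
    h; these are bounded by Cauchy-Schwarz. *)
Lemma gradient_dot_le (R : realType) (c x h : 'rV[R]_2) :
  dot x x ^+ 2 + 2 * dot x x * dot c c = 4 * dot x c ^+ 2 ->
  dot (x + h) (x + h) ^+ 2 + 2 * dot (x + h) (x + h) * dot c c =
    4 * dot (x + h) c ^+ 2 ->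
  4 * `|dot h (gradient c x)| <=
    dot h h * (10 * dot x x + 6 * dot c c + 2 * dot h h).
Proof.
move=> ex eh.
have -> : dot h (gradient c x) =
    (dot x x + dot c c) * dot x h - 2 * dot x c * dot h c.
  by rewrite !coordE !mxE !coordE; ring.
have e1 : dot (x + h) (x + h) = dot x x + 2 * dot x h + dot h h.
  by rewrite !coordE !mxE; ring.
have e2 : dot (x + h) c = dot x c + dot h c.
  by rewrite !coordE !mxE; ring.
rewrite e1 e2 in eh.
have m2 : dot x h ^+ 2 <= dot x x * dot h h.
  by rewrite -dot_cross_sqr lerDl sqr_ge0.
have g2 : dot h c ^+ 2 <= dot c c * dot h h.
  by rewrite [leRHS]mulrC -dot_cross_sqr lerDl sqr_ge0.
have := dot_ge0 x; have := dot_ge0 c; have := dot_ge0 h.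
move: (dot x x) (dot c c) (dot h h) (dot x h) (dot x c) (dot h c)
  ex eh m2 g2 {e1 e2} => A B H m p g ex eh m2 g2 H0 B0 A0.
have s1 := sqr_ge0 (2 * m - H); have s2 := sqr_ge0 (2 * m + H).
have s3 := sqr_ge0 g.
have AH := mulr_ge0 A0 H0; have BH := mulr_ge0 B0 H0; have HH := sqr_ge0 H.
rewrite -[X in X * `|_|](@ger0_norm _ 4) // -normrM.
have -> : 4 * ((A + B) * m - 2 * p * g) =
    4 * g ^+ 2 - (2 * m + H) ^+ 2 - 2 * (A + B) * H by lra.
by rewrite ler_norml; apply/andP; split; lra.
Qed.

Lemma enorm_cvg0 (R : realType) (X : 'rV[R]_2) :
  enorm (Y - X) @[Y --> X] --> (0 : R).
Proof.
have c i : (Y : 'rV[R]_2) 0 i - X 0 i @[Y --> X] --> (0 : R).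
  rewrite -(subrr (X 0 i)).
  have cX := @coord_continuous R 1 2 0 i X.
  exact: (cvgB cX (cvg_cst _)).
have -> : (fun Y : 'rV[R]_2 => enorm (Y - X)) = (fun Y => Num.sqrt
    ((Y 0 0 - X 0 0) * (Y 0 0 - X 0 0) + (Y 0 1 - X 0 1) * (Y 0 1 - X 0 1))).
  by apply/funext => Y; rewrite /enorm dotE !mxE.
have h : (Y 0 0 - X 0 0) * (Y 0 0 - X 0 0) + (Y 0 1 - X 0 1) * (Y 0 1 - X 0 1)
    @[Y --> X] --> (0 * 0 + 0 * 0 : R).
  exact: (cvgD (cvgM (c 0) (c 0)) (cvgM (c 1) (c 1))).
have -> : 0 = Num.sqrt (0 * 0 + 0 * 0) :> R by rewrite mulr0 addr0 sqrtr0.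
by apply: continuous_cvg h; exact: sqrt_continuous.
Qed.

(** The cross product of h with G turned by a right angle is h.G, so the estimate
    of [gradient_dot_le] bounds the sine by a multiple of |h|. *)
Lemma sine_gradient_cvg (R : realType) (O c x : 'rV[R]_2) :
  x != 0 -> lemniscate (O + c) (O - c) (O + x) ->
  sine (O + x) Y (O + x + rot90 (gradient c x))
    @[Y --> within (lemniscate (O + c) (O - c)) (O + x)^'] --> (0 : R).
Proof.
move=> x0 Cx; set X := O + x; set C := lemniscate _ _; set G := gradient c x.
have ex : dot x x ^+ 2 + 2 * dot x x * dot c c = 4 * dot x c ^+ 2.
  by move/lemniscate_center: Cx; rewrite addrAC subrr add0r.
have G0 : 0 < enorm G by rewrite enorm_gt0 gradient_neq0.
have e : enorm (Y - X) @[Y --> within C X^'] --> (0 : R).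
  by do 2 apply: cvg_within_filter; exact: enorm_cvg0.
pose K := 10 * dot x x + 6 * dot c c.
pose k (t : R) := t * (K + 2 * (t * t)) / (4 * enorm G).
have kc : k (enorm (Y - X)) @[Y --> within C X^'] --> (0 : R).
  have k0 : 0 * (K + 2 * (0 * 0)) * (4 * enorm G)^-1 = 0 by rewrite !mul0r.
  rewrite -[X in _ --> X]k0 /k.
  exact: (cvgM (cvgM e (cvgD (cvg_cst K) (cvgM (cvg_cst (2 : R)) (cvgM e e))))
               (cvg_cst (4 * enorm G)^-1)).
apply: squeeze_cvgr (@cvg_cst _ _ _ _ _) kc.
near=> Y.
have YX : Y != X by near: Y; exact: near_within_dnbhs_neq.
have CY : C Y by near: Y; exact: withinT.
apply/andP; split; first by rewrite /sine divr_ge0 ?mulr_ge0 ?enorm_ge0.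
rewrite /sine [X + _ - X]addrAC subrr add0r; set h := Y - X.
have hp : 0 < enorm h by rewrite enorm_gt0 subr_eq0.
have -> : cross h (rot90 G) = dot h G by rewrite !coordE; ring.
have -> : enorm (rot90 G) = enorm G.
  by congr Num.sqrt; rewrite !coordE; ring.
have := @gradient_dot_le _ c x h ex; rewrite -/G.
have -> : x + h = Y - O by rewrite /h /X opprD addrCA addrA addrAC addrA subrK.
move=> /(_ (iffLR (lemniscate_center O c Y) CY)).
rewrite -[dot h h]enorm_sqr /k => le.
rewrite ler_pdivrMr ?mulr_gt0 //.
rewrite -/K in le.
have -> : enorm h * (K + 2 * (enorm h * enorm h)) / (4 * enorm G) * (enorm h * enorm G) =
    enorm h ^+ 2 * (K + 2 * enorm h ^+ 2) / 4 by field; rewrite gt_eqF.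
by lra.
Unshelve. all: by end_near. Qed.

(** Substituting w = r u in |w|^4 + 2 |w|^2 |c|^2 = 4 (w.c)^2 with r <> 0 gives
    r^2 |u|^4 = 4 (u.c)^2 - 2 |u|^2 |c|^2.  The directions u = x + s J x, with J the
    rotation by a right angle, give a curve through x at s = 0. *)
Lemma lemniscate_limit_point (R : realType) (O c x : 'rV[R]_2) :
  x != 0 -> lemniscate (O + c) (O - c) (O + x) ->
  limit_point (lemniscate (O + c) (O - c)) (O + x).
Proof.
move=> x0 /lemniscate_center; rewrite [_ + x - _]addrAC subrr add0r => ex.
have A0 : 0 < dot x x by rewrite dot_gt0.
set A := dot x x in ex A0; set p := dot x c in ex; set q := cross x c.
pose r2 (s : R) := 4 * ((p + s * q) * (p + s * q)) - 2 * dot c c * (A * (1 + s * s)).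
pose r (s : R) := Num.sqrt (r2 s) / (A * (1 + s * s)).
pose Y (s : R) := O + r s *: (x + s *: rot90 x).
have sq s : 0 < A * (1 + s * s) by rewrite mulr_gt0 // ltr_wpDr // -expr2 sqr_ge0.
have e : (s : R) @[s --> 0^'] --> (0 : R).
  by apply: cvg_within_filter; exact: cvg_id.
have sqc : A * (1 + s * s) @[s --> (0 : R)^'] --> A * (1 + 0 * 0).
  exact: (cvgM (cvg_cst A) (cvgD (cvg_cst (1 : R)) (cvgM e e))).
have r2c : r2 s @[s --> 0^'] --> r2 0.
  have e' : p + s * q @[s --> (0 : R)^'] --> p + 0 * q.
    exact: (cvgD (cvg_cst p) (cvgM e (cvg_cst q))).
  exact: (cvgB (cvgM (cvg_cst (4 : R)) (cvgM e' e'))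
               (cvgM (cvg_cst (2 * dot c c)) sqc)).
have rc : r s @[s --> 0^'] --> r 0.
  have sc : Num.sqrt (r2 s) @[s --> 0^'] --> Num.sqrt (r2 0).
    by apply: continuous_cvg r2c; exact: sqrt_continuous.
  by apply: (cvgM sc (cvgV _ sqc)); rewrite gt_eqF.
have r20 : r2 0 = A ^+ 2.
  by rewrite /r2; lra.
have r0 : r 0 = 1.
  by rewrite /r r20 sqrtr_sqr gtr0_norm // mulr0 addr0 mulr1 divff ?gt_eqF.
have Yc : Y s @[s --> 0^'] --> O + x.
  have e0 : O + x = O + r 0 *: (x + 0 *: rot90 x) by rewrite r0 scale0r addr0 scale1r.
  rewrite e0.
  exact: (cvgD (cvg_cst O) (cvgZ rc (cvgD (cvg_cst x) (cvgZ e (cvg_cst (rot90 x)))))).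
move=> U nU.
have YU : \forall s \near 0^', U (Y s) by exact: Yc.
have r2p : \forall s \near 0^', 0 < r2 s.
  by apply: (cvgr_gt _ r2c); rewrite r20 exprn_gt0.
have nz : \forall s \near (0 : R)^', s != 0 by exact: withinT.
have PF : ProperFilter (0 : R)^' by exact: Proper_dnbhs_numFieldType.
have /(@filter_ex _ _ PF)[s [[Us rs] sn]] :
    \forall s \near (0 : R)^', (U (Y s) /\ 0 < r2 s) /\ s != 0.
  by apply: filterI => //; apply: filterI.
have rp : 0 < r s by rewrite divr_gt0 ?sqrtr_gt0.
exists (Y s); split => //.
- apply: contraNneq sn => /addrI /(congr1 (cross x)).
  have -> : cross x (r s *: (x + s *: rot90 x)) = r s * s * A.
    by rewrite /A !coordE !mxE /=; ring.
  have -> : cross x x = 0 by rewrite coordE; ring.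
  by move/eqP; rewrite mulf_eq0 (gt_eqF A0) orbF mulf_eq0 (gt_eqF rp).
- apply/lemniscate_center; rewrite [_ + _ *: _ - _]addrAC subrr add0r.
  have -> : dot (r s *: (x + s *: rot90 x)) (r s *: (x + s *: rot90 x)) =
            r s ^+ 2 * (A * (1 + s * s)).
    by rewrite /A !coordE !mxE /=; ring.
  have -> : dot (r s *: (x + s *: rot90 x)) c = r s * (p + s * q).
    by rewrite /p /q !coordE !mxE /=; ring.
  have rE : r s ^+ 2 * (A * (1 + s * s)) ^+ 2 = r2 s.
    by rewrite /r expr_div_n sqr_sqrtr ?ltW // divfK // expf_neq0 // gt_eqF.
  have -> : (r s ^+ 2 * (A * (1 + s * s))) ^+ 2 = r s ^+ 2 * r2 s.
    by rewrite -rE; ring.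
  by rewrite /r2; ring.
Qed.

(** * The normal line *)

Lemma line_left (R : realType) (A B : 'rV[R]_2) : line A B A.
Proof. by exists 0; rewrite scale0r addr0. Qed.

Lemma line_right (R : realType) (A B : 'rV[R]_2) : line A B B.
Proof. by exists 1; rewrite scale1r addrCA subrr addr0. Qed.

Lemma perpendicular_lines (R : realType) (A B P Q : 'rV[R]_2) :
  A <> B -> P <> Q -> dot (B - A) (Q - P) = 0 ->
  perpendicular (line A B) (line P Q).
Proof.
move=> AB PQ d; split; [by exists A, B|by exists P, Q|].
move=> _ _ _ _ [s ->] [s' ->] [t ->] [t' ->].
have -> : dot (A + s' *: (B - A) - (A + s *: (B - A)))
              (P + t' *: (Q - P) - (P + t *: (Q - P))) =
          (s' - s) * (t' - t) * dot (B - A) (Q - P).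
  by rewrite !coordE !mxE; ring.
by rewrite d mulr0.
Qed.

Lemma tangent_line_lemniscate (R : realType) (O c x : 'rV[R]_2) :
  x != 0 -> lemniscate (O + c) (O - c) (O + x) ->
  tangent_line (lemniscate (O + c) (O - c)) (O + x)
    (line (O + x) (O + x + rot90 (gradient c x))).
Proof.
move=> x0 Cx; split => //; first exact: lemniscate_limit_point.
have g0 : O + x + rot90 (gradient c x) != O + x.
  rewrite -subr_eq0 addrAC subrr add0r -dot_gt0.
  have -> : dot (rot90 (gradient c x)) (rot90 (gradient c x)) =
            dot (gradient c x) (gradient c x) by rewrite !coordE; ring.
  rewrite dot_gt0; apply: gradient_neq0 => //.
  by move/lemniscate_center: Cx; rewrite addrAC subrr add0r.
exists (O + x + rot90 (gradient c x)); split => //; first exact/eqP.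
by apply/line_angle_cvg0 => //; exact: sine_gradient_cvg.
Qed.

Lemma normal_line_lemniscate (R : realType) (O c X N : 'rV[R]_2) :
  X != O -> lemniscate (O + c) (O - c) X -> N != X ->
  cross (gradient c (X - O)) (N - X) = 0 ->
  normal_line (lemniscate (O + c) (O - c)) X (line X N).
Proof.
rewrite -(subr_eq0 X O); have := subrKC O X; move: (X - O) => x <-.
move=> x0 Cx NX cr; split; first exact: line_left.
have tg := tangent_line_lemniscate x0 Cx.
exists (line (O + x) (O + x + rot90 (gradient c x))); split.
  by split=> [//|T]; apply: tangent_line_eq.
have [_ _ [Z [ZX e _]]] := tg.
apply: perpendicular_lines; [by apply/eqP; rewrite eq_sym| |].
  move=> e'; apply: ZX; have : line (O + x) Z Z by exact: line_right.
  by rewrite -e -e' => -[t ->]; rewrite subrr scaler0 addr0.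
rewrite [_ + rot90 _ - _]addrAC subrr add0r -cr.
by rewrite !coordE; ring.
Qed.

(** The function P |-> (X - O) x (P - O) is affine and vanishes exactly on OX; if
    its values at N and F had a nonpositive product, it would vanish at a point of
    the segment NF. *)
Lemma same_side_cross (R : realType) (O X N F : 'rV[R]_2) :
  X != O -> cross (X - O) (F - O) != 0 -> same_side O X N F ->
  0 < cross (X - O) (N - O) * cross (X - O) (F - O).
Proof.
move=> XO v0 ss; rewrite ltNge; apply/negP => uv.
set x := X - O in v0 uv; set u := cross x (N - O) in uv.
set v := cross x (F - O) in v0 uv.
have vv : 0 < v ^+ 2 by rewrite lt_def sqr_ge0 expf_neq0.
have d0 : u - v != 0.
  by apply: contraTneq uv => /eqP; rewrite subr_eq0 => /eqP ->; rewrite -ltNge -expr2.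
(* The zero of the affine function with values u at N and v at F. *)
pose t := u / (u - v); pose P := N + t *: (F - N).
have : (line O X `&` segment N F) P; last by rewrite ss.
split; last first.
  exists t; split => //; have dd : 0 < (u - v) ^+ 2 by rewrite lt_def sqr_ge0 expf_neq0.
  have -> : t = u * (u - v) / (u - v) ^+ 2 by rewrite /t; field.
  have u2 := sqr_ge0 u.
  have t0 : 0 <= u * (u - v) by lra.
  by rewrite divr_ge0 ?sqr_ge0 //= ler_pdivrMr // mul1r; lra.
have xP : cross x (P - O) = 0.
  have -> : cross x (P - O) = u + t * (v - u).
    by rewrite /u /v !coordE !mxE; ring.
  by rewrite /t; field.
have x0 : x != 0 by rewrite subr_eq0.
have e := collinear x0 xP.
exists (dot x (P - O) / dot x x).
by rewrite -/x -e subrKC.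
Qed.

Lemma cross_gradient_opp (R : realType) (c x : 'rV[R]_2) :
  cross (gradient c x) (- x) = - 2 * dot x c * cross x c.
Proof. by rewrite !coordE !mxE !coordE; ring. Qed.

(** Here C is the cosine of the angle between x and c, and n makes with -x the
    double of that angle, on the side of c.  Lagrange's identity gives the sines up
    to sign, the side condition fixes the sign, and the equation of the curve
    then makes the two components of G proportional to those of n. *)
Lemma double_angle_normal (R : realType) (c x n : 'rV[R]_2) (C : R) :
  x != 0 -> c != 0 -> 0 < C ->
  dot x x ^+ 2 + 2 * dot x x * dot c c = 4 * dot x c ^+ 2 ->
  dot x c = enorm x * enorm c * C ->
  dot x n = - (enorm x * enorm n * (2 * C ^+ 2 - 1)) ->
  0 < cross x n * cross x c ->
  cross (gradient c x) n = 0.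
Proof.
move=> x0 c0 C0 ex xc xn side.
have a0 : 0 < enorm x by rewrite enorm_gt0.
have b0 : 0 < enorm c by rewrite enorm_gt0.
have n0 := enorm_ge0 n.
have kk := dot_cross_sqr x c; have jj := dot_cross_sqr x n.
rewrite xn -!enorm_sqr in jj; rewrite xc -!enorm_sqr in ex kk.
have E : dot x x * cross (gradient c x) n =
    (dot x x + dot c c) * dot x x * cross x n
    - 2 * dot x c ^+ 2 * cross x n + 2 * dot x c * cross x c * dot x n.
  by rewrite !coordE !mxE !coordE; ring.
rewrite xc xn -!enorm_sqr in E.
move: (enorm x) (enorm c) (enorm n) (cross x n) (cross x c) (cross (gradient c x) n)
  a0 b0 n0 side ex kk jj E {xc xn}.
move=> a b v j k g a0 b0 v0 side ex kk jj E.
(* With S the sine for which k = a b S, this is sin 2u = 2 sin u cos u. *)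
have bj : b * j = 2 * v * C * k.
  have /eqP : (b * j) ^+ 2 = (2 * v * C * k) ^+ 2.
    have -> : (b * j) ^+ 2 = b ^+ 2 * (a ^+ 2 * v ^+ 2 - (a * v * (2 * C ^+ 2 - 1)) ^+ 2).
      by rewrite -jj; ring.
    have -> : (2 * v * C * k) ^+ 2 = 4 * v ^+ 2 * C ^+ 2 * (a ^+ 2 * b ^+ 2 - (a * b * C) ^+ 2).
      by rewrite -kk; ring.
    by ring.
  rewrite eqf_sqr => /orP[/eqP //|/eqP h].
  have : 0 < b * (j * k) by rewrite mulr_gt0.
  rewrite mulrA h ltNge => /negP[].
  have -> : - (2 * v * C * k) * k = - (2 * v * C * k ^+ 2) by ring.
  by rewrite oppr_le0 mulr_ge0 ?sqr_ge0 // mulr_ge0 ?(ltW C0) // mulr_ge0.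
have nz : b * a ^+ 2 != 0 by rewrite mulf_neq0 ?expf_neq0 ?gt_eqF.
suff : b * a ^+ 2 * g = 0 by move/eqP; rewrite mulf_eq0 (negbTE nz) => /eqP.
rewrite -mulrA E.
have -> : b * ((a ^+ 2 + b ^+ 2) * a ^+ 2 * j - 2 * (a * b * C) ^+ 2 * j +
    2 * (a * b * C) * k * - (a * v * (2 * C ^+ 2 - 1))) =
    ((a ^+ 2 + b ^+ 2) * a ^+ 2 - 2 * (a * b * C) ^+ 2) * (b * j)
    - 2 * (a * b) ^+ 2 * C * k * v * (2 * C ^+ 2 - 1) by ring.
rewrite bj.
have -> : ((a ^+ 2 + b ^+ 2) * a ^+ 2 - 2 * (a * b * C) ^+ 2) * (2 * v * C * k)
    - 2 * (a * b) ^+ 2 * C * k * v * (2 * C ^+ 2 - 1) =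
    2 * v * C * k * ((a ^+ 2) ^+ 2 + 2 * a ^+ 2 * b ^+ 2 - 4 * (a * b * C) ^+ 2) by ring.
by rewrite ex subrr mulr0.
Qed.

(** Both the curve and its centre are symmetric in the foci, so the chosen focus can
    be written O + c and the other one O - c. *)
Lemma lemniscate_focus (R : realType) (F1 F2 F : 'rV[R]_2) :
  F = F1 \/ F = F2 ->
  lemniscate F1 F2 = lemniscate (midpoint F1 F2 + (F - midpoint F1 F2))
                                (midpoint F1 F2 - (F - midpoint F1 F2)).
Proof.
have e A B : midpoint A B - (A - midpoint A B) = B :> 'rV[R]_2.
  by apply: row2P; rewrite !mxE; field.
case=> ->; rewrite subrKC; first by rewrite e.
have mC : midpoint F1 F2 = midpoint F2 F1 by rewrite /midpoint addrC.
have dC A B : dist A B = dist B A :> R.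
  rewrite /dist /enorm -(opprB A B) /dot; congr Num.sqrt.
  by apply: eq_bigr => i _; rewrite !mxE mulrNN.
rewrite mC e; apply/funext => Y; rewrite /lemniscate /=.
by rewrite mulrC (dC F1 F2).
Qed.

Theorem mainTheorem5 (R : realType) (F1 F2 O X F : 'rV[R]_2)
    (L : set 'rV[R]_2)
    (F1_neq_F2 : F1 <> F2)
    (O_mid : O = midpoint F1 F2)
    (X_lemn : lemniscate F1 F2 X)
    (X_neq_O : X <> O)
    (F_focus : F = F1 \/ F = F2)
    (F_acute : angle X O F < pi / 2)
    (L_zero : angle X O F = 0 -> L = line O X)
    (L_pos : angle X O F <> 0 -> exists N : 'rV[R]_2,
       [/\ N <> X, angle O X N = 2 * angle X O F,
           same_side O X N F & L = line X N]) :
  normal_line (lemniscate F1 F2) X L.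
Proof.
have FO : F - O != 0.
  rewrite subr_eq0; apply/eqP => e; apply: F1_neq_F2.
  have e0 i : 2 * F 0 i = F1 0 i + F2 0 i by rewrite e O_mid !mxE; field.
  by case: F_focus e0 => -> e0; apply: row2P; have := e0 0; have := e0 1; lra.
have XO : X - O != 0 by rewrite subr_eq0; apply/eqP.
move: X_lemn; rewrite (lemniscate_focus F_focus) -O_mid => X_lemn.
have ex := iffLR (lemniscate_center O (F - O) X) X_lemn.
have ab0 : 0 < enorm (X - O) * enorm (F - O) by rewrite mulr_gt0 ?enorm_gt0.
set c := F - O in FO X_lemn ex ab0 *; set x := X - O in XO ex ab0.
have xc : dot x c = enorm x * enorm c * cos (angle X O F).
  by rewrite cos_angle mulrC divfK // gt_eqF.
have C0 : 0 < cos (angle X O F).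
  by apply: cos_gt0_pihalf; have := angle_itv X O F; have := @pi_gt0 R; lra.
have kk := dot_cross_sqr x c.
have [z|nz] := eqVneq (angle X O F) 0.
  have k0 : cross x c = 0.
    move: kk; rewrite xc z cos0 mulr1 exprMn !enorm_sqr => /eqP.
    by rewrite -subr_eq0 addrAC subrr add0r sqrf_eq0 => /eqP.
  have -> : L = line X O.
    rewrite (L_zero z); apply/seteqP; split=> _ [t ->]; exists (1 - t);
    by apply: row2P; rewrite !mxE; ring.
  apply: normal_line_lemniscate => //; rewrite -/x.
  - exact/eqP.
  - by rewrite eq_sym; exact/eqP.
  - have -> : O - X = - x by rewrite opprB.
    by rewrite cross_gradient_opp k0 mulr0.
have [N [/eqP NX aN ss ->]] := L_pos (fun e => negP nz (introT eqP e)).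
apply: normal_line_lemniscate => //; first exact/eqP.
have NX0 : 0 < enorm (N - X) by rewrite enorm_gt0 subr_eq0.
have k0 : cross x c != 0.
  apply: contraNneq nz => k0.
  have nz2 : (enorm x * enorm c) ^+ 2 != 0 by rewrite expf_neq0 // gt_eqF.
  have : cos (angle X O F) ^+ 2 = 1.
    apply: (mulfI nz2); rewrite mulr1 -exprMn -xc exprMn !enorm_sqr -kk k0.
    by rewrite expr0n addr0.
  move/eqP; rewrite sqrf_eq1 => /orP[/eqP h|/eqP h].
    rewrite -[angle X O F]cosK; first by rewrite h acos1.
    by rewrite in_itv /= angle_itv.
  by move: C0; rewrite h ltr0N1.
apply: (@double_angle_normal _ _ _ _ (cos (angle X O F))) => //.
- have := cos_angle O X N; rewrite aN mulr_natl cos_mulr2n.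
  have -> : O - X = - x by rewrite opprB.
  have -> : enorm (- x) = enorm x by congr Num.sqrt; rewrite !coordE !mxE; ring.
  have -> : dot (- x) (N - X) = - dot x (N - X) by rewrite !coordE !mxE; ring.
  move=> h; have -> : 2 * cos (angle X O F) ^+ 2 - 1 = - dot x (N - X) / (enorm x * enorm (N - X)).
    by rewrite -h; ring.
  by field; rewrite (gt_eqF NX0) gt_eqF ?enorm_gt0.
- have -> : cross (X - O) (N - X) = cross (X - O) (N - O).
    by rewrite !coordE !mxE; ring.
  by apply: same_side_cross ss => //; exact/eqP.
Qed.
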